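(* Let $q$ be a prime power and $g\ge1$ a fixed integer. Information packets are partitioned into $n$ disjoint generations each of size $g$. At each transmission (over a perfect channel) the source independently chooses one generation uniformly at random (probability $1/n$ each) and sends a linear combination of its packets with coefficient vector drawn uniformly from $GF(q)^{g}$; decoding fails after $t$ received coded packets if some generation has not yet received $g$ linearly independent coefficient vectors. Then, as $n\to\infty$, the probability of decoding failure when $t$ coded packets have been collected is greater than \[ 1-\exp\Bigl[-\frac{1}{(g-1)!}\,n(\log n)^{g-1}\exp\Bigl(-\frac{t}{n}\Bigr)\Bigr]+\mathcal{O}\Bigl(\frac{\log\log n}{\log n}\Bigr). \] *)

(* Defs.v *)
From HB Require Import structures.
From mathcomp Require Import all_boot all_order all_algebra.
From mathcomp Require Import reals.
From mathcomp Require Import sequences.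
From mathcomp.analysis Require Import exp.
Set Implicit Arguments. Unset Strict Implicit. Unset Printing Implicit Defensive.
Import Order.TTheory GRing.Theory Num.Theory.
Local Open Scope ring_scope.

(* An outcome of t transmissions: for each transmission k < t, the chosen
   generation (in 'I_n) and the coefficient vector (in GF(q)^g).
   The uniform distribution on this finite type is exactly: each transmission
   independently picks a generation uniformly and a vector uniformly. *)
Definition outcome (F : finFieldType) (n g t : nat) :=
  {ffun 'I_t -> 'I_n * 'rV[F]_g}.

(* Matrix whose rows are the coefficient vectors received for generation j
   (rows of other generations replaced by 0, which does not change the span). *)
Definition gen_mx (F : finFieldType) (n g t : nat) (w : outcome F n g t)
  (j : 'I_n) : 'M[F]_(t, g) :=
  \matrix_(k < t, l < g) (if (w k).1 == j then (w k).2 0 l else 0).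

Definition decoding_fails (F : finFieldType) (n g t : nat) (w : outcome F n g t)
  : bool := [exists j : 'I_n, \rank (gen_mx w j) < g]%N.

Definition fail_prob (R : realType) (F : finFieldType) (n g t : nat) : R :=
  (#|[set w : outcome F n g t | decoding_fails w]|%:R)
  / (#|{: outcome F n g t}|%:R).

(* Main.v *)
(* Decoding fails as soon as some generation has received fewer than g packets.
   The events "generation j has received at least g packets" are negatively
   dependent, so with u = P(Bin(t, 1/n) < g) success has probability at most
   (1 - u)^n <= exp(-n u).  Keeping only the term Bin(t, 1/n) = g - 1 = s gives
   n u >= m (1 - O(log n / n)), where m = n (log n)^s e^(-t/n) / s!, as long as
   n log n + s <= t <= (s + 2) n log n.  Beyond this range e^(-m) >= 1 - 1/n;
   below it (for s > 0) the success probability is at most its value at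
   t ~ n log n, which is O(1 / log n). *)
Require Import Defs.
From HB Require Import structures.
From mathcomp Require Import all_boot all_order all_algebra.
From mathcomp Require Import reals.
From mathcomp Require Import sequences.
From mathcomp.analysis Require Import exp.
From mathcomp Require Import ring lra zify.
Import Order.TTheory GRing.Theory Num.Theory.
Local Open Scope ring_scope.

(** * Negative dependence of occupancy counts *)

(** The left-hand side collects the terms of degree at most one in [e] of the expanded product; the
    dropped terms are nonnegative. *)
Lemma prodD_ge (R : realDomainType) (I : eqType) (r : seq I) (a e : I -> R) :
  uniq r -> (forall i, 0 <= a i) -> (forall i, 0 <= e i) ->
  \prod_(i <- r) a i + \sum_(j <- r) e j * \prod_(i <- r | i != j) a i
    <= \prod_(i <- r) (a i + e i).
Proof.
move=> + a0 e0; elim: r => [|k r IH]; first by rewrite !big_nil addr0.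
move=> /= /andP[kr ur]; rewrite !big_cons eqxx /=.
have -> : \prod_(i <- r | i != k) a i = \prod_(i <- r) a i.
  rewrite big_seq_cond [RHS]big_seq; apply: eq_bigl => i.
  by case: (boolP (i \in r)) => //= ir; apply: contraNneq kr => <-.
have -> : \sum_(j <- r) e j * \prod_(i <- k :: r | i != j) a i
        = a k * \sum_(j <- r) e j * \prod_(i <- r | i != j) a i.
  rewrite mulr_sumr !big_seq; apply: eq_bigr => j jr.
  have kj : k != j by apply: contraNneq kr => ->.
  by rewrite big_cons kj mulrCA.
apply: le_trans (ler_wpM2l _ (IH ur)); last exact: addr_ge0.
have S0 : 0 <= \sum_(j <- r) e j * \prod_(i <- r | i != j) a i.
  by apply: sumr_ge0 => j _; rewrite mulr_ge0// prodr_ge0.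
by have := mulr_ge0 (e0 k) S0; nra.
Qed.

(* P(Bin(t, x) >= v), by conditioning on one trial. *)
Fixpoint binom_tail {R : realFieldType} (x : R) (t v : nat) : R :=
  if t is t'.+1 then (1 - x) * binom_tail x t' v + x * binom_tail x t' v.-1
  else (v == 0)%:R.

Lemma binom_tail_ge0 (R : realFieldType) (x : R) t v :
  0 <= x <= 1 -> 0 <= binom_tail x t v.
Proof.
case/andP=> x0 x1; elim: t v => [|t IH] v /=; first exact: ler0n.
by rewrite addr_ge0// mulr_ge0// subr_ge0.
Qed.

Lemma binom_tail0 (R : realFieldType) (x : R) t : binom_tail x t 0 = 1.
Proof. by elim: t => //= t ->; rewrite !mulr1 subrK. Qed.

Lemma binom_tail_pred (R : realFieldType) (x : R) t v :
  0 <= x <= 1 -> binom_tail x t v <= binom_tail x t v.-1.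
Proof.
case/andP=> x0 x1; elim: t v => [|t IH] [|v] //=.
by rewrite lerD ?ler_wpM2l ?subr_ge0//; exact: (IH v.+1).
Qed.

Lemma binom_tail_mono (R : realFieldType) (x : R) t t' v :
  0 <= x <= 1 -> (t <= t')%N -> binom_tail x t v <= binom_tail x t' v.
Proof.
move=> hx; elim: t' => [|t' IH]; first by rewrite leqn0 => /eqP->.
rewrite leq_eqVlt => /predU1P[->//|/IH tt']; apply: (le_trans tt') => /=.
have := binom_tail_pred _ x t' v hx; case/andP: hx => x0 x1 h.
by have := ler_wpM2l x0 h; lra.
Qed.

(** P(Bin(t, x) <= s) is at least P(Bin(t, x) = s). Weakening the exponent [t - s] of [1 - x] to [t]
    avoids truncated subtraction and leaves an induction by Pascal's rule, with slack [h3]. *)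
Lemma binom_tail_le (R : realFieldType) (x : R) t s : 0 <= x <= 1 ->
  'C(t, s)%:R * x ^+ s * (1 - x) ^+ t <= 1 - binom_tail x t s.+1.
Proof.
move=> hx; have /andP[x0 x1] := hx; have y0 : 0 <= 1 - x by rewrite subr_ge0.
have y1 : 1 - x <= 1 by lra.
elim: t s => [|t IH] [|s] /=.
- by rewrite bin0 !expr0; lra.
- by rewrite bin0n/= !mul0r; lra.
- by have := ler_wpM2l y0 (IH 0%N); rewrite !bin0 binom_tail0 !expr0 exprS; lra.
have h1 := ler_wpM2l y0 (IH s.+1); have h2 := ler_wpM2l x0 (IH s).
have z0 : 0 <= 'C(t, s)%:R * x ^+ s.+1 * (1 - x) ^+ t :> R.
  by rewrite !mulr_ge0// exprn_ge0.
have h3 := mulr_ge0 x0 z0.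
rewrite binS natrD !exprS in h1 h2 h3 z0 *.
by lra.
Qed.

Definition ffcons {T : finType} {t} (x : T) (f : {ffun 'I_t -> T}) :
  {ffun 'I_t.+1 -> T} := [ffun k => if unlift ord0 k is Some l then f l else x].

Lemma card_ffun_ordS (T : finType) t (P : pred {ffun 'I_t.+1 -> T}) :
  #|[pred f | P f]|
    = (\sum_(x : T) #|[pred f : {ffun 'I_t -> T} | P (ffcons x f)]|)%N.
Proof.
pose h (p : T * {ffun 'I_t -> T}) := ffcons p.1 p.2.
have hb : {on [pred f | P f], bijective h}.
  exists (fun f : {ffun 'I_t.+1 -> T} => (f ord0, [ffun l => f (lift ord0 l)])).
    move=> [x f] _ /=; congr pair; first by rewrite ffunE unlift_none.
    by apply/ffunP => l; rewrite !ffunE liftK.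
  move=> f _; apply/ffunP => k; rewrite !ffunE.
  by case: unliftP => [l ->|->] //; rewrite ffunE.
rewrite -sum1_card (reindex h)//=.
rewrite -(pair_big_dep xpredT (fun x f => P (ffcons x f)) (fun _ _ => 1%N))/=.
by apply: eq_bigr => x _; rewrite sum1_card.
Qed.

Lemma card_ffcons (T J : finType) (c : T -> J) t x (f : {ffun 'I_t -> T}) j :
  #|[pred k | c (ffcons x f k) == j]| = ((c x == j) + #|[pred k | c (f k) == j]|)%N.
Proof.
rewrite -!sum1_card big_mkcond big_ord_recl /= inE /ffcons ffunE unlift_none.
rewrite [in RHS]big_mkcond; congr (_ + _)%N.
by apply: eq_bigr => k _; rewrite !inE ffunE liftK.
Qed.

(* Write a_j for the tail of t draws and a_j + d_j for its value at v_j - 1.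
   Conditioning on one draw turns the product bound for t draws into
   prod a + sum_j p_j d_j prod_(i != j) a_i, the first-order part of the
   product prod (a_j + p_j d_j) of the tails of t + 1 draws. *)
Lemma occupancy_le_prod (R : realFieldType) (T J : finType) (c : T -> J)
    (p : J -> R) t (v : J -> nat) : (0 < #|T|)%N ->
  (forall j, p j = #|[pred x | c x == j]|%:R / #|T|%:R) ->
  #|[pred f : {ffun 'I_t -> T} |
      [forall j, v j <= #|[pred k | c (f k) == j]|]%N]|%:R
    <= #|T|%:R ^+ t * \prod_j binom_tail (p j) t (v j).
Proof.
move=> T0 pE; have T0' : 0 < #|T|%:R :> R by rewrite ltr0n.
have p01 j : 0 <= p j <= 1.
  by rewrite pE divr_ge0//= ler_pdivrMr// mul1r ler_nat max_card.
have p1 : \sum_j p j = 1.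
  under eq_bigr do rewrite pE; rewrite -mulr_suml -natr_sum.
  have -> : (\sum_j #|[pred x | c x == j]| = #|T|)%N.
    rewrite -sum1_card (partition_big c xpredT)//=.
    by apply: eq_bigr => j _; rewrite sum1_card.
  by rewrite divff// gt_eqF.
elim: t v => [|t IH] v.
  rewrite expr0 mul1r; have [v0|] := boolP [forall j, v j == 0%N].
    rewrite big1 => [|j _]; last by rewrite /= (forallP v0).
    rewrite -[leRHS]/(1%:R) ler_nat (leq_trans (max_card _))//.
    by rewrite card_ffun card_ord expn0.
  case/forallPn => j vj; rewrite (bigD1 j)//= (negbTE vj) mul0r.
  rewrite -[leRHS]/(0%:R) ler_nat leqn0 eq_card0// => f.
  rewrite !inE; apply/negbTE/forallPn; exists j; rewrite -ltnNge.
  by rewrite eq_card0 ?lt0n// => -[].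
(* What the other [t] draws must still supply once the first has landed in [i]; truncation at 0
   matches [v.-1] in [binom_tail]. *)
pose v' i j := (v j - (i == j))%N.
pose a j := binom_tail (p j) t (v j).
pose d j := binom_tail (p j) t (v j).-1 - a j.
have a0 j : 0 <= a j by exact: binom_tail_ge0.
have d0 j : 0 <= d j by rewrite subr_ge0 binom_tail_pred.
rewrite card_ffun_ordS natr_sum.
have step x : #|[pred f : {ffun 'I_t -> T} | [forall j,
    v j <= #|[pred k | c (ffcons x f k) == j]|]%N]|%:R
    <= #|T|%:R ^+ t * (\prod_j a j + d (c x) * \prod_(j | j != c x) a j).
  have -> : #|[pred f : {ffun 'I_t -> T} | [forall j,
      v j <= #|[pred k | c (ffcons x f k) == j]|]%N]|
    = #|[pred f : {ffun 'I_t -> T} | [forall j,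
      v' (c x) j <= #|[pred k | c (f k) == j]|]%N]|.
    apply: eq_card => f; rewrite !inE; apply: eq_forallb => j.
    by rewrite card_ffcons leq_subLR.
  apply: (le_trans (IH _)); rewrite ler_wpM2l ?exprn_ge0 ?(ltW T0')//.
  have -> : \prod_j a j = a (c x) * \prod_(j | j != c x) a j.
    by rewrite (bigD1 (c x)).
  rewrite (bigD1 (c x))//= -mulrDl /d addrC subrK /v' eqxx subn1.
  rewrite [X in _ * X <= _](eq_bigr a)// => j jx.
  by rewrite eq_sym (negbTE jx) subn0.
apply: (le_trans (ler_sum _ (fun x _ => step x))).
rewrite -mulr_sumr exprSr -mulrA ler_wpM2l ?exprn_ge0 ?(ltW T0')//.
have -> : \prod_j binom_tail (p j) t.+1 (v j) = \prod_j (a j + p j * d j).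
  by apply: eq_bigr => j _ /=; rewrite /d /a; ring.
apply: le_trans (ler_wpM2l (ltW T0') (prodD_ge _ _ _ a (fun j => p j * d j)
  (index_enum_uniq _) a0 _)); last first.
  by move=> j; rewrite mulr_ge0//; case/andP: (p01 j).
rewrite le_eqVlt; apply/predU1P; left.
rewrite (partition_big c xpredT)//=.
under eq_bigr => j _.
  under eq_bigr => x /eqP -> do over.
  rewrite sumr_const -mulr_natl.
  have -> : #|[pred x | c x == j]|%:R = #|T|%:R * p j :> R.
    by rewrite pE mulrC divfK// gt_eqF.
  over.
rewrite /=; under eq_bigr do rewrite -mulrA mulrDr.
rewrite -mulr_sumr big_split/= -mulr_suml p1 mul1r; congr (_ * (_ + _)).
by apply: eq_bigr => j _; rewrite mulrA.
Qed.

(** * From decoding to occupancy counts *)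

(** The row space is spanned by the rows belonging to [j], and each adds at most 1 to the rank. *)
Lemma rank_gen_mx_le (F : finFieldType) n g t (w : outcome F n g t) j :
  (\rank (gen_mx w j) <= #|[pred k | (w k).1 == j]|)%N.
Proof.
pose A := gen_mx w j.
have sA : (A <= \sum_(k | (w k).1 == j) <<row k A>>)%MS.
  apply/row_subP => k; have [kj|kj] := boolP ((w k).1 == j).
    by rewrite (sumsmx_sup k)// genmxE.
  suff -> : row k A = 0 by rewrite sub0mx.
  by apply/rowP => l; rewrite !mxE (negbTE kj).
apply: (leq_trans (mxrankS sA)); rewrite -sum1_card.
elim/big_rec2: _ => [|k m B _ IH]; first by rewrite mxrank0.
apply: (leq_trans (mxrank_adds_leqif _ _)); apply: leq_add => //.
by rewrite genmxE rank_leq_row.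
Qed.

(** By the rank bound, every successful outcome gives each generation at least [g] packets;
    [occupancy_le_prod] with all cells of probability [1/n] bounds the number of such outcomes. *)
Lemma fail_prob_ge (R : realType) (F : finFieldType) n g t : (0 < n)%N ->
  1 - binom_tail (n%:R^-1) t g ^+ n <= fail_prob R F n g t.
Proof.
move=> n0; pose T := ('I_n * 'rV[F]_g)%type.
have V0 : (0 < #|{: 'rV[F]_g}|)%N by apply/card_gt0P; exists 0.
have cT : #|{: T}| = (n * #|{: 'rV[F]_g}|)%N by rewrite card_prod card_ord.
have T0 : (0 < #|{: T}|)%N by rewrite cT muln_gt0 n0.
have pE (j : 'I_n) : n%:R^-1 = #|[pred x : T | x.1 == j]|%:R / #|{: T}|%:R :> R.
  have -> : #|[pred x : T | x.1 == j]| = #|{: 'rV[F]_g}|.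
    transitivity (#|pred1 j| * #|{: 'rV[F]_g}|)%N; last by rewrite card1 mul1n.
    by rewrite -cardX; apply: eq_card => -[i y]; rewrite !inE andbT.
  by rewrite cT natrM; field; rewrite !pnatr_eq0 -!lt0n n0 V0.
have := occupancy_le_prod R T 'I_n fst (fun _ => n%:R^-1) t (fun _ => g) T0 pE.
rewrite prodr_const card_ord /fail_prob.
set S := #|[pred w : {ffun 'I_t -> T} |
  [forall j, (g <= #|[pred k | (w k).1 == j]|)%N]]|.
have cO : #|{: outcome F n g t}| = (#|{: T}| ^ t)%N.
  by rewrite card_ffun card_ord.
have O0 : 0 < #|{: outcome F n g t}|%:R :> R by rewrite ltr0n cO expn_gt0 T0.
rewrite -natrX -cO mulrC => h.
have hS : (#|{: outcome F n g t}| <= #|[set w : outcome F n g t | decoding_fails w]| + S)%N.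
  rewrite -(cardsC [set w : outcome F n g t | decoding_fails w]) leq_add2l.
  apply: subset_leq_card; apply/subsetP => w; rewrite !inE.
  move=> nf; apply/forallP => j; apply: contraR nf; rewrite -ltnNge => cj.
  by apply/existsP; exists j; apply: leq_ltn_trans (rank_gen_mx_le _ _ _ _ w j) cj.
rewrite ler_pdivlMr// mulrBl mul1r lerBlDr.
by move: hS; rewrite -(ler_nat R) natrD; lra.
Qed.

(** * Estimates for the binomial tail *)

Lemma invn_itv (R : realFieldType) n : 0 <= (n%:R^-1 : R) <= 1.
Proof.
rewrite invr_ge0 ler0n /=; case: n => [|n]; first by rewrite invr0 ler01.
by rewrite invf_le1 ?ltr0n// ler1n.
Qed.

Lemma bernoulli_1B (R : realDomainType) (y : R) t :
  0 <= y <= 1 -> 1 - t%:R * y <= (1 - y) ^+ t.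
Proof.
case/andP=> y0 y1; elim: t => [|t IH]; first by rewrite mul0r subr0 expr0.
have h : (1 - y) * (1 - t%:R * y) <= (1 - y) ^+ t.+1.
  by rewrite exprS ler_wpM2l// subr_ge0.
apply: le_trans h; rewrite -natr1.
by have := mulr_ge0 (mulr_ge0 (ler0n R t) y0) y0; lra.
Qed.

(** From [1 + x <= expR x] follows [expR (- x) * (1 - x ^+ 2) <= 1 - x]; take [t]-th powers and
    apply Bernoulli to [1 - x ^+ 2]. *)
Lemma exprn_1B_ge (R : realType) (x : R) t : 0 <= x <= 1 ->
  expR (- (t%:R * x)) * (1 - t%:R * x ^+ 2) <= (1 - x) ^+ t.
Proof.
move=> /andP[x0 x1]; have x2 : 0 <= x ^+ 2 <= 1.
  by rewrite exprn_ge0//= exprn_ile1.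
apply: le_trans (ler_wpM2l (expR_ge0 _) (bernoulli_1B R _ t x2)) _.
rewrite -mulrN expRM_natl -exprMn; apply: lerXn2r; rewrite ?nnegrE ?subr_ge0//.
  by rewrite mulr_ge0 ?expR_ge0 ?subr_ge0//; case/andP: x2.
rewrite expRN mulrC ler_pdivrMr ?expR_gt0//.
have -> : 1 - x ^+ 2 = (1 - x) * (1 + x) by ring.
by rewrite ler_wpM2l ?subr_ge0// expR_ge1Dx.
Qed.

Lemma bin_fact_ge t s : ((t - s) ^ s <= 'C(t, s) * s`!)%N.
Proof.
rewrite bin_ffact; elim: s => // s IH; rewrite ffactnSr expnSr leq_mul//.
  apply: leq_trans IH; case: s => [|s]; first by rewrite !expn0.
  by rewrite leq_exp2r// leq_sub2l.
by rewrite leq_sub2l.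
Qed.

(* The factor e^(-y/2) hidden in the left-hand side absorbs y, so that the
   error does not depend on y. *)
Lemma expR_perturb (R : realType) (y e : R) : 0 <= y -> 0 <= e <= 2^-1 ->
  expR (- (y * (1 - e))) <= expR (- y) + 2 * e.
Proof.
move=> y0 /andP[e0 e2].
have h1 : expR (- (y * (1 - e))) * (1 - y * e) <= expR (- y).
  have -> : - y = - (y * (1 - e)) + - (y * e) by ring.
  rewrite expRD ler_wpM2l ?expR_ge0//.
  exact: le_trans (expR_ge1Dx _).
have h2 : y * expR (- (y * (1 - e))) <= 2.
  rewrite expRN ler_pdivrMr ?expR_gt0//.
  by have := expR_ge1Dx (y * (1 - e)); nra.
by nra.
Qed.

(* Asymptotically, near t = n ln n, the expected number of the n bins that have
   received at most s of the t draws. *)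
Definition mean_deficient {R : realType} (s n t : nat) : R :=
  s`!%:R^-1 * n%:R * ln n%:R ^+ s * expR (- (t%:R / n%:R)).

Lemma mean_deficient_ge0 (R : realType) s n t : 0 <= mean_deficient s n t :> R.
Proof.
rewrite /mean_deficient; case: n => [|n]; first by rewrite mulr0 !mul0r.
by rewrite !mulr_ge0 ?expR_ge0 ?exprn_ge0 ?ln_ge0 ?invr_ge0// ler1n.
Qed.

(** Here [e] is the relative loss in replacing [(1 - 1/n) ^+ t] by [expR (- (t/n))]. The first
    hypothesis compares [s]-th powers so that it is void for [s = 0], where [t] then needs no lower
    bound. *)
Lemma binom_tail_le_expR (R : realType) (s n t : nat) (e : R) : (0 < n)%N ->
  ln n%:R ^+ s <= ((t - s)%:R / n%:R) ^+ s :> R ->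
  t%:R / n%:R ^+ 2 <= e -> e <= 2^-1 ->
  binom_tail n%:R^-1 t s.+1 ^+ n <= expR (- mean_deficient s n t) + 2 * e.
Proof.
move=> n0 hL he e2; have n0' : 0 < n%:R :> R by rewrite ltr0n.
have x01 := invn_itv R n.
have e0 : 0 <= e by apply: le_trans he; rewrite divr_ge0// exprn_ge0.
have m0 := mean_deficient_ge0 R s n t.
apply: le_trans (expR_perturb R _ _ m0 _); last by rewrite e0.
set u : R := 'C(t, s)%:R * n%:R^-1 ^+ s * (1 - n%:R^-1) ^+ t.
have pu : binom_tail n%:R^-1 t s.+1 <= expR (- u).
  apply: le_trans (expR_ge1Dx _); have := binom_tail_le R _ t s x01.
  by rewrite -/u; lra.
apply: le_trans (lerXn2r n _ _ pu) _; rewrite ?nnegrE ?expR_ge0//.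
  exact: binom_tail_ge0.
rewrite -expRM_natl ler_expR mulrN lerN2 /mean_deficient /u.
have sf0 : 0 < s`!%:R :> R by rewrite ltr0n fact_gt0.
have h1 : s`!%:R^-1 * ln n%:R ^+ s <= 'C(t, s)%:R * n%:R^-1 ^+ s :> R.
  rewrite mulrC ler_pdivrMr//; apply: (le_trans hL).
  rewrite expr_div_n exprVn mulrAC ler_wpM2r ?invr_ge0 ?exprn_ge0//.
  by rewrite -natrX -natrM ler_nat bin_fact_ge.
have h2 : expR (- (t%:R / n%:R)) * (1 - e) <= (1 - n%:R^-1) ^+ t.
  apply: le_trans (exprn_1B_ge R _ t x01); rewrite ler_wpM2l ?expR_ge0//.
  by rewrite exprVn lerD2l lerN2.
have -> : s`!%:R^-1 * n%:R * ln n%:R ^+ s * expR (- (t%:R / n%:R)) * (1 - e)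
  = n%:R * ((s`!%:R^-1 * ln n%:R ^+ s) * (expR (- (t%:R / n%:R)) * (1 - e))) by ring.
rewrite ler_wpM2l//; apply: ler_pM => //.
  by rewrite mulr_ge0 ?invr_ge0 ?exprn_ge0 ?ln_ge0 ?ler1n.
by rewrite mulr_ge0 ?expR_ge0//; lra.
Qed.

(** The exponential is at most [n ^ -(s + 2)], while [ln n <= n] bounds the remaining factors by
    [n ^ (s + 1)]. *)
Lemma mean_deficient_late (R : realType) (s n t : nat) : (0 < n)%N ->
  n%:R * (s.+2%:R * ln n%:R) <= t%:R :> R ->
  mean_deficient s n t <= n%:R^-1 :> R.
Proof.
move=> n0 ht; have n0' : 0 < n%:R :> R by rewrite ltr0n.
have n1 : 1 <= n%:R :> R by rewrite ler1n.
have sf : s`!%:R^-1 <= 1 :> R by rewrite invf_le1 ?ltr0n ?ler1n fact_gt0.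
have Ln : ln n%:R <= n%:R :> R.
  rewrite -{2}(@lnK R n%:R) ?posrE//; apply: le_trans (expR_ge1Dx _).
  by rewrite lerDr.
have hE : expR (- (t%:R / n%:R)) <= n%:R^-1 ^+ s.+2 :> R.
  rewrite exprVn -{2}(@lnK R n%:R) ?posrE// -expRM_natl -expRN ler_expR lerN2.
  by rewrite ler_pdivlMr// mulrC.
rewrite /mean_deficient; have l0 : 0 <= ln n%:R :> R by exact: ln_ge0.
apply: (@le_trans _ _ ((1 * n%:R) * n%:R ^+ s * n%:R^-1 ^+ s.+2)).
  by rewrite !ler_pM ?mulr_ge0 ?exprn_ge0 ?expR_ge0 ?invr_ge0// lerXn2r ?nnegrE.
rewrite mul1r -exprS exprVn [n%:R ^+ s.+2]exprS invfM mulrCA divff ?mulr1//.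
by rewrite expf_neq0 ?gt_eqF.
Qed.

(** In this range [n * expR (- (t/n))] is at least [expR (- (s + 1))], and [ln n <= ln n ^+ s]
    because [s > 0]. So the mean is at least a constant times [ln n], and [expR (- y) <= 1/y]
    concludes. *)
Lemma mean_deficient_early (R : realType) (s n t : nat) : (0 < n)%N ->
  (0 < s)%N -> 1 <= ln n%:R :> R -> t%:R <= n%:R * ln n%:R + s.+1%:R :> R ->
  expR (- mean_deficient s n t)
    <= s`!%:R * expR s.+1%:R / ln n%:R :> R.
Proof.
move=> n0 s0 L1 ht; have n0' : 0 < n%:R :> R by rewrite ltr0n.
have L0 : 0 < ln n%:R :> R by exact: lt_le_trans L1.
have sf0 : 0 < s`!%:R :> R by rewrite ltr0n fact_gt0.
set y := mean_deficient s n t.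
suff hy : ln n%:R / (s`!%:R * expR s.+1%:R) <= y :> R.
  have q0 : 0 < ln n%:R / (s`!%:R * expR s.+1%:R) :> R.
    by rewrite divr_gt0// mulr_gt0// expR_gt0.
  rewrite -[leRHS]invf_div expRN lef_pV2 ?posrE ?expR_gt0//.
  by apply: (le_trans hy); apply: le_trans (expR_ge1Dx y); rewrite lerDr.
have hE : n%:R^-1 * (expR s.+1%:R)^-1 <= expR (- (t%:R / n%:R)) :> R.
  rewrite -{1}(@lnK R n%:R) ?posrE// -!expRN -expRD ler_expR -opprD lerN2.
  rewrite ler_pdivrMr//; apply: (le_trans ht).
  have : 1 <= n%:R :> R by rewrite ler1n.
  by have := ler0n R s.+1; nra.
have LL : ln n%:R <= ln n%:R ^+ s :> R by apply: ler_eXnr.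
rewrite /y /mean_deficient.
have -> : ln n%:R / (s`!%:R * expR s.+1%:R) = s`!%:R^-1 * n%:R * ln n%:R *
    (n%:R^-1 * (expR s.+1%:R)^-1) :> R.
  by field; rewrite !gt_eqF// expR_gt0.
rewrite ler_pM ?mulr_ge0 ?invr_ge0 ?expR_ge0 ?(ltW n0') ?(ltW L0)//.
by rewrite ler_wpM2l// mulr_ge0 ?invr_ge0.
Qed.

(** * Constants and the ranges of [t] *)

Theorem theorem6 (R : realType) (q : nat) (F : finFieldType) (g : nat)
  (hq : #|F| = q) (hg : (1 <= g)%N) :
  exists (C : R) (N : nat), forall n t : nat, (N <= n)%N ->
    fail_prob R F n g t >
      1 - expR (- ((g.-1)`!%:R^-1 * n%:R * (ln (n%:R : R)) ^+ g.-1
                   * expR (- (t%:R / n%:R))))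
        - C * (ln (ln (n%:R : R)) / ln (n%:R : R)).
Proof.
case: g hg => // s _; rewrite /=.
(* The summands of [D] are the errors of [main] and of [mean_deficient_early], times [L]. In [K],
   the first summand forces [e <= 1/2] and the second [ln L >= 1]. *)
pose D : R := 4 * s.+2%:R + s`!%:R * expR s.+1%:R.
pose K : R := 4 * s.+2%:R + expR 1.
(* The extra 1 makes the final inequality strict: [D / L < (D + 1) * (ln L / L)] as [ln L >= 1]. *)
exists (D + 1), (Num.truncn (expR K)).+1 => n t Nn.
have KL : K <= ln n%:R.
  rewrite -[K]expRK ler_ln ?posrE ?expR_gt0//; last first.
    by rewrite ltr0n (leq_trans _ Nn).
  by apply/ltW/(lt_le_trans (truncnS_gt _)); rewrite ler_nat.
have n0 : (0 < n)%N by rewrite (leq_trans _ Nn).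
have n0' : 0 < n%:R :> R by rewrite ltr0n.
have s2 : 2 <= s.+2%:R :> R by rewrite ler_nat.
have e1 := expR_gt0 (1 : R).
set L := ln n%:R in KL *.
have L1 : 1 <= L by apply: le_trans KL; rewrite /K; lra.
have L0 : 0 < L by exact: lt_le_trans L1.
have LL1 : 1 <= ln L.
  rewrite -[leLHS]expRK ler_ln ?posrE ?expR_gt0//.
  by apply: le_trans KL; rewrite /K; lra.
have nL2 : L ^+ 2 / 2 <= n%:R.
  rewrite -(@lnK R n%:R) ?posrE// -/L.
  by have := expR_ge1Dxn 1%N (ltW L0); rewrite -[(2`!)%N]/2%N; lra.
(* The largest value of [t / n ^+ 2] for [t <= (s + 2) n L]; it is [O(1 / L)] by [nL2]. *)
pose e : R := s.+2%:R * L / n%:R.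
have eL : e <= 2 * s.+2%:R / L.
  by rewrite /e ler_pdivrMr// mulrAC ler_pdivlMr//; nra.
have eh : e <= 2^-1.
  apply: (le_trans eL); rewrite ler_pdivrMr//; move: KL; rewrite /K; lra.
have D0 : 0 <= D.
  by rewrite /D addr_ge0 ?mulr_ge0 ?expR_ge0//.
have main t' : ln n%:R ^+ s <= ((t' - s)%:R / n%:R) ^+ s :> R ->
    t'%:R <= n%:R * (s.+2%:R * L) ->
    binom_tail n%:R^-1 t' s.+1 ^+ n
      <= expR (- mean_deficient s n t') + 4 * s.+2%:R / L :> R.
  move=> h1 h2; apply: le_trans (binom_tail_le_expR R _ _ _ e n0 h1 _ eh) _.
    by rewrite /e expr2 invfM mulrA ler_pM2r ?invr_gt0// ler_pdivrMr// mulrC.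
  by rewrite lerD2l; move: eL; lra.
have x01 := invn_itv R n.
suff S : binom_tail n%:R^-1 t s.+1 ^+ n
    <= expR (- mean_deficient s n t) + D / L :> R.
  apply: lt_le_trans (fail_prob_ge R F n s.+1 t n0).
  have : D / L < (D + 1) * (ln L / L).
    rewrite mulrA ltr_pM2r ?invr_gt0//; nra.
  by move: S; rewrite /mean_deficient -/L; lra.
have D1 : 4 * s.+2%:R / L <= D / L.
  by rewrite ler_pM2r ?invr_gt0// lerDl mulr_ge0 ?expR_ge0.
(* For late [t] the right-hand side is already at least 1, since
   [expR (- m) >= 1 - m >= 1 - 1/n]. *)
have [late|/ltW tle] := leP (n%:R * (s.+2%:R * L)) t%:R.
  have h1 := mean_deficient_late R s n t n0 late.
  have nL : n%:R^-1 <= L^-1.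
    rewrite lef_pV2 ?posrE// -[X in _ <= X](@lnK R n%:R) ?posrE// -/L.
    by have := expR_ge1Dx L; lra.
  have h2 : L^-1 <= D / L.
    by rewrite -[leLHS]mul1r ler_pM2r ?invr_gt0//; rewrite /D;
       have := mulr_ge0 (ler0n R s`!) (expR_ge0 s.+1%:R); lra.
  apply: (@le_trans _ _ 1).
    rewrite exprn_ile1 ?binom_tail_ge0//.
    have := binom_tail_le R _ t s x01; have /andP[x0 x1] := x01.
    suff : 0 <= 'C(t, s)%:R * n%:R^-1 ^+ s * (1 - n%:R^-1) ^+ t :> R by lra.
    by rewrite !mulr_ge0 ?exprn_ge0 ?subr_ge0.
  by have := expR_ge1Dx (- mean_deficient s n t : R); lra.
have big t' : n%:R * L + s%:R <= t'%:R ->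
    ln n%:R ^+ s <= ((t' - s)%:R / n%:R) ^+ s :> R.
  move=> ht; have st : (s <= t')%N.
    by rewrite -(ler_nat R); apply: le_trans ht; rewrite lerDr mulr_ge0// ltW.
  rewrite lerXn2r ?nnegrE ?divr_ge0 ?(ltW L0) ?(ltW n0')//.
  by rewrite ler_pdivlMr// natrB// mulrC lerBrDr.
have [s0|s0] := posnP s.
  apply: (le_trans (main t _ tle)); last by rewrite lerD2l.
  by rewrite s0 !expr0.
have [ht|/ltW ht] := leP (n%:R * L + s%:R) t%:R.
  by apply: (le_trans (main t (big _ ht) tle)); rewrite lerD2l.
(* For smaller [t], monotonicity in [t] passes to [t0], which satisfies the lower bound of [big] and
   exceeds it by at most 1, so that [mean_deficient_early] applies as well. *)
pose t0 := ((Num.truncn (n%:R * L)).+1 + s)%N.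
have nL0 : 0 <= n%:R * L by rewrite mulr_ge0 ?ltW.
have /andP[tr1 tr2] := truncn_itv nL0.
have t0l : n%:R * L + s%:R <= t0%:R by rewrite /t0 natrD lerD2r ltW.
have t0u : t0%:R <= n%:R * L + s.+1%:R.
  by rewrite /t0 natrD -!natr1; lra.
have tt0 : (t <= t0)%N by rewrite -(ler_nat R) (le_trans ht).
apply: (@le_trans _ _ (binom_tail n%:R^-1 t0 s.+1 ^+ n)).
  by rewrite lerXn2r ?nnegrE ?binom_tail_ge0// binom_tail_mono.
apply: (le_trans (main t0 (big _ t0l) _)).
  apply: (le_trans t0u).
  have : 1 <= n%:R * L by rewrite mulr_ege1// ler1n.
  by have := ler0n R s; rewrite -!natr1; nra.
have := mean_deficient_early R s n t0 n0 s0 L1 t0u; rewrite -/L => h.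
rewrite /D mulrDl; have := expR_ge0 (- mean_deficient s n t : R); lra.
Qed.
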